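(* If a problem $A$ admits a polynomial formulation of complexity $t(n)$, then $A \in \mathrm{POTIME}[O(t(n)),\mathcal Q]$ for some explicit polynomial family $\mathcal Q$.
   Context: A family $\mathcal P=\{P_s\}$ of polynomials over $\mathbb Z$ is $\Delta$-explicit if for all $s$, $P_s$ (in $s$ variables) has degree at most $\Delta$, coefficients of absolute value $O(s^\Delta)$, all computable in time $O(s^\Delta)$. A $\Delta$-explicit family $\mathcal P$ is a polynomial formulation of $A$ of complexity $T$ if there are a non-decreasing $s(n)\le T(n)$ computable in time $T(n)$ and maps $\phi_n\colon A_n\to\mathbb Z^{s(n)}$ (where $A_n$ is the set of instances of size $n$) computable in time $T(n)$ such that for every $x\in A_n$: $P_{s(n)}(\phi_n(x))\neq 0$ iff $x$ is a yes-instance, and the entries of $\phi_n(x)$ have absolute value less than $2^{s(n)^{o(1)}}$. $\mathrm{POTIME}[t,\mathcal Q]$ is the class of problems solvable in deterministic time $t(n)$ with oracle calls to $\mathcal Q$, where a call on integers $a_1,\dots,a_s$ with $|a_i|=2^{s^{o(1)}}$ returns $Q_s(a_1,\dots,a_s)$ in time $s$. *)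

(* Defs.v *)
From HB Require Import structures.
From mathcomp Require Import all_boot all_order all_algebra.
From mathcomp Require Import all_classical all_reals all_analysis.
(* The notations of mpoly clash with those of all_analysis. *)
From mathcomp Require Import -(notations) mpoly.

Set Implicit Arguments.
Unset Strict Implicit.
Unset Printing Implicit Defensive.

Import Order.TTheory GRing.Theory Num.Theory.
Import numFieldNormedType.Exports.

Local Open Scope classical_set_scope.
Local Open Scope ring_scope.

Definition bigO (f g : nat -> nat) : Prop :=
  exists C N : nat, forall n, (N <= n)%N -> (f n <= C * g n)%N.

(* A program has registers, addressed directly and used as scratch space, and
   a memory addressed by integers.  Registers and memory cells hold arbitrary
   integers, but an instruction is charged according to the number of machine
   words its operands occupy: this is the word RAM, with multi-word integers
   handled by schoolbook arithmetic.  Operands of O(w) bits cost O(1). *)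

Inductive binop := Add | Sub | Mul | Div.

Inductive instr :=
  | Const of nat & int
  | Bin of binop & nat & nat & nat
  | Fetch of nat & nat
  | Store of nat & nat
  | Jz of nat & nat
  | Jpos of nat & nat
  | Query of nat & nat & nat.

Definition program := seq instr.

Record state := State { pc : nat; regs : nat -> int; mem : int -> int }.

(* [None] means that the oracle may not be called on these integers; a program
   that makes such a call has no run. *)
Definition oracle := forall s : nat, ('I_s -> int) -> option int.

Definition no_oracle : oracle := fun _ _ => None.

(* The number of w-bit words occupied by the binary expansion of |z|. *)
Definition words (w : nat) (z : int) : nat := ((trunc_log 2 `|z|) %/ w).+1.

Definition eval_binop (o : binop) (x y : int) : int :=
  match o with
  | Add => x + y
  | Sub => x - y
  | Mul => x * y
  | Div => (x %/ y)%Z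
  end.

Definition binop_cost (w : nat) (o : binop) (x y : int) : nat :=
  match o with
  | Add | Sub => (words w x + words w y)%N
  | Mul | Div => (words w x * words w y)%N
  end.

Definition set_reg (st : state) (i : nat) (v : int) : state :=
  State (pc st).+1 [eta regs st with i |-> v] (mem st).

Definition set_mem (st : state) (a v : int) : state :=
  State (pc st).+1 (regs st) [eta mem st with a |-> v].

Definition jump (st : state) (b : bool) (l : nat) : state :=
  State (if b then l else (pc st).+1) (regs st) (mem st).

(* The cost and the next state.  A call on s integers costs s, except that no
   call is free; the integers are in s consecutive memory cells. *)
Definition exec (w : nat) (O : oracle) (c : instr) (st : state) :
    option (nat * state) :=
  let r := regs st in
  match c with
  | Const i z => Some (words w z, set_reg st i z)
  | Bin o i j k =>
      Some (binop_cost w o (r j) (r k), set_reg st i (eval_binop o (r j) (r k)))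
  | Fetch i j =>
      let v := mem st (r j) in
      Some ((words w (r j) + words w v)%N, set_reg st i v)
  | Store i j =>
      Some ((words w (r i) + words w (r j))%N, set_mem st (r i) (r j))
  | Jz i l => Some (1%N, jump st (r i == 0) l)
  | Jpos i l => Some (1%N, jump st (0 < r i) l)
  | Query i j k =>
      let s := `|r j|%N in
      if O s (fun a : 'I_s => mem st (r k + (a : nat)%:Z)) is Some v
      then Some (maxn 1 s, set_reg st i v) else None
  end.

(* [run w O p st c st']: from state [st], program [p] halts in state [st']
   after total cost [c].  Halting (the program counter leaves the program)
   counts for one unit. *)
Inductive run (w : nat) (O : oracle) (p : program) :
    state -> nat -> state -> Prop :=
  | run_halt st of (size p <= pc st)%N : run w O p st 1 st
  | run_step st i c1 st1 c2 st2 of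
      onth p (pc st) = Some i & exec w O i st = Some (c1, st1)
      & run w O p st1 c2 st2 : run w O p st (c1 + c2) st2.

(* Input: the length in register 0, the entries in memory cells 0, 1, ... *)
Definition init (x : seq int) : state :=
  State 0 (fun i => if i == 0%N then (size x)%:Z else 0)
        (fun a => if a is Posz i then x`_i else 0).

(* Output: the length in register 0, the entries in memory cells 0, 1, ... *)
Definition output (st : state) : seq int :=
  mkseq (fun i => mem st i%:Z) `|regs st 0%N|%N.

(* Words are logarithmic in the input size and the running time. *)
Definition word_length (T : nat -> nat) (n : nat) : nat :=
  (trunc_log 2 (n + T n)).+1.

(* [p] halts on the input encoded by [x], of size [n], within time [T n],
   in state [st]. *)
Definition halts_in (O : oracle) (T : nat -> nat) (p : program)
    (n : nat) (x : seq int) (st : state) : Prop :=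
  exists2 c, run (word_length T n) O p (init x) c st & (c <= T n)%N.

(* One program computes [f] on all sizes; it is given the code only. *)
Definition computable_in (I : Type) (sz : I -> nat) (code f : I -> seq int)
    (T : nat -> nat) : Prop :=
  exists p, forall x, exists2 st,
    halts_in no_oracle T p (sz x) (code x) st & output st = f x.

Definition nat_computable_in (f : nat -> seq int) (T : nat -> nat) : Prop :=
  computable_in (fun n : nat => n) (fun n : nat => [:: n%:Z]) f T.

Definition poly_family := forall s : nat, mpoly s int.

(* The k-th monomial of degree at most D in s variables, for k < (s+1)^D:
   if d_0, ..., d_{D-1} are the digits of k in base s+1, it is the product of
   the x_{d_j}, where x_0 stands for 1 and x_1, ..., x_s are the variables. *)
Definition nth_monomial (s D k : nat) : multinom s :=
  Multinom [tuple (\sum_(j < D) ((k %/ s.+1 ^ j) %% s.+1 == i.+1))%N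
               | i < s].

(* All the coefficients of a polynomial of degree at most D; a monomial may be
   listed several times (at most D! times). *)
Definition coef_table (s D : nat) (p : mpoly s int) : seq int :=
  mkseq (fun k => mcoeff (nth_monomial s D k) p) (s.+1 ^ D).

Definition explicit_family (D : nat) (P : poly_family) : Prop :=
  [/\ forall s, (mpoly.msize (P s) <= D.+1)%N (* msize is degree + 1 *),
      exists2 c : nat -> nat, bigO c (fun s => s ^ D)%N
        & forall s m, (`|mcoeff m (P s)| <= (c s)%:Z)%R
    & exists2 T : nat -> nat, bigO T (fun s => s ^ D)%N
        & nat_computable_in (fun s => coef_table D (P s)) T].

(* The instances are given to programs as sequences of integers (possibly
   bits); the size is a parameter of the instance, e.g. the number of vertices
   or of variables, and need not be the length of the code. *)
Record problem := Problem {
  instance :> Type;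
  isize : instance -> nat;
  code : instance -> seq int;
  yes : instance -> Prop }.

(* phi x is the image of x under phi_n, for n the size of x. *)
Definition polynomial_formulation (R : realType) (A : problem)
    (T : nat -> nat) (P : poly_family) : Prop :=
  exists (s : nat -> nat) (phi : forall x : A, 'I_(s (isize x)) -> int)
         (eps : nat -> R),
  [/\ {homo s : m n / (m <= n)%N} /\ (forall n, (s n <= T n)%N),
      nat_computable_in (fun n => [:: (s n)%:Z]) T,
      computable_in (@isize A) (@code A) (fun x => codom (phi x)) T,
      forall x : A, meval (phi x) (P (s (isize x))) != 0 <-> yes x
    & eps n @[n --> \oo] --> 0 /\
      forall (x : A) i,
        `|phi x i|%:~R < 2 `^ ((s (isize x))%:R `^ eps (isize x))].

Definition has_polynomial_formulation (R : realType) (A : problem)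
    (T : nat -> nat) : Prop :=
  exists D P, explicit_family D P /\ polynomial_formulation R A T P.

(* Calls on s integers are allowed if these are at most 2^(s^(eps s)). *)
Definition poly_oracle (R : realType) (Q : poly_family) (eps : nat -> R) :
    oracle :=
  fun s a =>
    if [forall i : 'I_s, `|a i|%:~R <= 2 `^ (s%:R `^ eps s)]
    then Some (meval a (Q s)) else None.

(* The answer, 1 or 0, is left in register 0; the same o(1) bounds the oracle
   calls on all instances. *)
Definition POTIME (R : realType) (T : nat -> nat) (Q : poly_family)
    (A : problem) : Prop :=
  exists (eps : nat -> R) (p : program), eps n @[n --> \oo] --> 0 /\
    forall x : A, exists2 st,
      halts_in (poly_oracle Q eps) T p (isize x) (code x) st
      & (yes x -> regs st 0%N = 1) /\ (~ yes x -> regs st 0%N = 0).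

Definition POTIME_O (R : realType) (t : nat -> nat) (Q : poly_family)
    (A : problem) : Prop :=
  exists2 T, bigO T t & POTIME R T Q A.

(* Main.v *)
Require Import Defs.
From mathcomp Require Import all_boot all_order all_algebra.
From mathcomp Require Import all_classical all_reals all_analysis.
From mathcomp Require Import zify.
From mathcomp Require Import -(notations) mpoly.

(** The family of the formulation itself serves as oracle: compute [phi x],
    which the program leaves exactly where an oracle call expects it, call the
    oracle once and test the answer for zero.  The time bound grows by a
    constant factor; words can only get longer, so costs only decrease.  The
    exponent allowed to a call on [m] integers must depend on [m] only: it is
    the supremum of [eps n] over the sizes [n] with [s n = m].  It tends to 0
    because [s] is monotone: either [s] is unbounded, and then [s n = m] forces
    [n] to be large, or [m] is eventually out of the range of [s]. *)

Set Implicit Arguments.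
Unset Strict Implicit.
Unset Printing Implicit Defensive.

Import Order.TTheory GRing.Theory Num.Theory.
Import numFieldNormedType.Exports.

Local Open Scope classical_set_scope.
Local Open Scope ring_scope.

Lemma words_anti (w w' : nat) (z : int) :
  (0 < w)%N -> (w <= w')%N -> (words w' z <= words w z)%N.
Proof. by move=> w0 ww'; rewrite /words ltnS leq_div2l. Qed.

Lemma binop_cost_anti (w w' : nat) (o : binop) (x y : int) :
  (0 < w)%N -> (w <= w')%N -> (binop_cost w' o x y <= binop_cost w o x y)%N.
Proof.
move=> w0 ww'; have le z := words_anti z w0 ww'.
by case: o; rewrite /= ?leq_add ?leq_mul.
Qed.

(* A program may halt by jumping beyond its end; clipping the jump targets makes
   it halt exactly at its end, so that code can be appended. *)
Definition clip (n : nat) (i : instr) : instr :=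
  match i with
  | Jz r l => Jz r (minn l n)
  | Jpos r l => Jpos r (minn l n)
  | _ => i
  end.

Definition clip_pc (n : nat) (st : state) : state :=
  State (minn (pc st) n) (regs st) (Defs.mem st).

Lemma clip_pc_id (n : nat) (st : state) :
  (pc st <= n)%N -> clip_pc n st = st.
Proof. by case: st => k r m /= /minn_idPl kn; rewrite /clip_pc /= kn. Qed.

(** A non-jump started below [n] reaches at most [n], where [clip_pc] is the identity; on jumps, the
    clipped target matches the clipped counter. The new oracle [O] is arbitrary because a [Query]
    has no execution under [no_oracle]. *)
Lemma exec_clip (w w' n : nat) (O : oracle) (i : instr) (st st1 : state)
    (c : nat) :
  (0 < w)%N -> (w <= w')%N -> (pc st < n)%N ->
  exec w no_oracle i st = Some (c, st1) ->
  exists2 c', exec w' O (clip n i) st = Some (c', clip_pc n st1) & (c' <= c)%N.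
Proof.
move=> w0 ww' ltn; have le z := words_anti z w0 ww'.
case: i => [r z|o r j k|r j|r j|r l|r l|//] [<- <-].
- by exists (words w' z); rewrite //= clip_pc_id.
- by eexists; rewrite /= ?clip_pc_id //; exact: binop_cost_anti.
- by eexists; rewrite /= ?clip_pc_id // leq_add.
- by eexists; rewrite /= ?clip_pc_id // leq_add.
- exists 1%N => //=; congr (Some (_, State _ _ _)) => /=.
  by case: ifP => // _; rewrite (minn_idPl ltn).
- exists 1%N => //=; congr (Some (_, State _ _ _)) => /=.
  by case: ifP => // _; rewrite (minn_idPl ltn).
Qed.

(** By induction on the run of [p]. The inequality is strict because the unit charged to [p] for
    halting is not paid again: control passes directly to [q]. *)
Lemma run_cat (w w' : nat) (O : oracle) (p q : program) (st st' : state)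
    (c : nat) :
  (0 < w)%N -> (w <= w')%N -> run w no_oracle p st c st' ->
  forall (c2 : nat) (st2 : state),
  let pq := map (clip (size p)) p ++ q in
  run w' O pq (clip_pc (size p) st') c2 st2 ->
  exists2 c', run w' O pq (clip_pc (size p) st) c' st2 & (c' < c + c2)%N.
Proof.
move=> w0 ww'; elim=> [{}st _|{}st i c1 st1 c2 {}st' pi ei _ IH] k st2 pq r2.
  by exists k.
have lt_pc : (pc st < size p)%N by rewrite -onthTE pi.
have [c1' ei' le1] := exec_clip O w0 ww' lt_pc ei.
have [c' r' lt'] := IH _ _ r2.
exists (c1' + c')%N; last by lia.
rewrite clip_pc_id ?(ltnW lt_pc) //; apply: run_step ei' r'.
by rewrite /pq onth_cat size_map lt_pc onth_map pi.
Qed.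

Lemma run_gt0 (w : nat) (O : oracle) (p : program) (st st' : state) (c : nat) :
  run w O p st c st' -> (0 < c)%N.
Proof. by elim=> // *; lia. Qed.

(** Here [n] is the address at which this code is placed. The output convention already puts the
    number of integers in register 0, so only the base address 0 is loaded, into register 1. A zero
    answer jumps to the end and is itself the output. *)
Definition query_tail (n : nat) : program :=
  [:: Const 1 0; Query 0 0 1; Jz 0 (n + 4); Const 0 1].

Lemma words1 (w : nat) (z : int) : (`|z| <= 1)%N -> words w z = 1%N.
Proof. by rewrite /words; case: `|z|%N => [|[|]] // _; rewrite div0n. Qed.

Lemma run_query_tail (w : nat) (O : oracle) (p : program) (st : state)
    (v : int) :
  pc st = size p ->
  O `|regs st 0%N|%N (fun a => Defs.mem st (a : nat)%:Z) = Some v ->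
  exists c st', [/\ run w O (p ++ query_tail (size p)) st c st',
    (c <= `|regs st 0%N| + 5)%N & regs st' 0%N = (v != 0)%:Z].
Proof.
case: st => k r m /= -> Ov; set n := size p; set pq := p ++ _.
have at_ j : onth pq (n + j) = onth (query_tail n) j.
  by rewrite /pq onth_cat -/n ltnNge leq_addr /= addKn.
have sz : size pq = (n + 4)%N by rewrite size_cat.
pose r1 := [eta r with 1%N |-> (0 : int)].
pose r2 := [eta r1 with 0%N |-> v].
pose r3 := [eta r2 with 0%N |-> (1 : int)].
have e0 : exec w O (Const 1 0) (State n r m) = Some (1%N, State n.+1 r1 m).
  by rewrite /= words1.
have e1 : exec w O (Query 0 0 1) (State n.+1 r1 m)
    = Some (maxn 1 `|r 0%N|, State n.+2 r2 m).
  rewrite /=.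
  have -> : (fun a : 'I_(`|r 0%N|%N) => m (0 + (a : nat)%:Z))
      = (fun a => m (a : nat)%:Z) by apply: funext => a; rewrite add0r.
  by rewrite Ov.
have e2 : exec w O (Jz 0 (n + 4)) (State n.+2 r2 m)
    = Some (1%N, State (if v == 0 then n + 4 else n.+3)%N r2 m) by [].
have e3 : exec w O (Const 0 1) (State n.+3 r2 m) = Some (1%N, State n.+4 r3 m).
  by rewrite /= words1.
have {}at_ j i : onth (query_tail n) j = Some i -> onth pq (j + n) = Some i.
  by rewrite addnC at_.
have prefix c' st' : run w O pq (State (if v == 0 then n + 4 else n.+3)%N r2 m) c' st' ->
    run w O pq (State n r m) (1 + (maxn 1 `|r 0%N| + (1 + c'))) st'.
  move=> H; apply: run_step e0 _; first exact: (at_ 0%N).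
  apply: run_step e1 _; first exact: (at_ 1%N).
  by apply: run_step e2 H; exact: (at_ 2%N).
have [v0|v0] := eqVneq v 0.
  eexists; exists (State (n + 4)%N r2 m); split.
  - by apply: prefix; rewrite v0 eqxx; apply: run_halt; rewrite sz.
  - by lia.
  - by rewrite /= v0.
eexists; exists (State n.+4 r3 m); split.
- apply: prefix; rewrite (negbTE v0); apply: run_step e3 _; first exact: (at_ 3%N).
  by apply: run_halt; rewrite sz addn4.
- by lia.
- by [].
Qed.

Section FiberSup.
Variables (R : realType) (s : nat -> nat) (eps : nat -> R).
Hypothesis eps0 : eps n @[n --> \oo] --> 0.

(** Including 0 keeps the set nonempty when [m] is not a value of [s], and makes its supremum
    nonnegative. *)
Let fiber (m : nat) : set R :=
  [set y | y = 0 \/ exists2 n, s n = m & y = `|eps n|].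

Definition fiber_sup (m : nat) : R := sup (fiber m).

Let fiber_sup_has (m : nat) : has_sup (fiber m).
Proof.
split; first by exists 0; left.
have [M [_ boundM]] : bounded_fun eps by apply: cvg_seq_bounded; apply/cvg_ex; exists 0.
exists (`|M| + 1) => y [->|[n _ ->]]; first by rewrite addr_ge0.
by apply: (boundM (`|M| + 1)) => //; rewrite (le_lt_trans (ler_norm M)) ?ltrDl.
Qed.

Lemma le_fiber_sup (n : nat) : eps n <= fiber_sup (s n).
Proof.
apply: le_trans (ler_norm _) _; apply: (ub_le_sup (fiber_sup_has (s n)).2).
by right; exists n.
Qed.

Lemma fiber_sup_cvg0 :
  {homo s : m n / (m <= n)%N} -> fiber_sup m @[m --> \oo] --> 0.
Proof.
move=> mono; apply/cvgrPdist_le => e e0.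
have /cvgrPdist_le/(_ _ e0)[N _ HN] := eps0.
(* For [m] beyond [s N], monotonicity forces [N <= n] whenever [s n = m]; if there is no such [n],
   only 0 remains. This treats bounded and unbounded [s] alike. *)
exists (s N).+1 => // m /= ltm; rewrite sub0r normrN ger0_norm; last first.
  by apply: (ub_le_sup (fiber_sup_has m).2); left.
apply: ge_sup (fiber_sup_has m).1 _ => y [->|[n snm ->]]; first exact: ltW.
have Nn : (N <= n)%N.
  by rewrite leqNgt; apply/negP => /ltnW /mono; rewrite snm leqNgt ltm.
by have := HN n Nn; rewrite sub0r normrN.
Qed.

End FiberSup.

(** The arity read from register 0 equals [s n] only propositionally, so the two argument tuples
    have different types. *)
Lemma poly_oracle_cast (R : realType) (Q : poly_family) (eps : nat -> R)
    (m n : nat) (a : 'I_m -> int) (b : 'I_n -> int) :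
  m = n -> (forall (i : 'I_m) (j : 'I_n), i = j :> nat -> a i = b j) ->
  poly_oracle Q eps a = poly_oracle Q eps b.
Proof.
move=> E; case: _ / E b => b ab.
by have -> : a = b by apply: funext => i; exact: ab.
Qed.

Lemma output_codomE (st : state) (n : nat) (f : 'I_n -> int) :
  output st = codom f ->
  `|regs st 0%N|%N = n /\ forall i : 'I_n, Defs.mem st (i : nat)%:Z = f i.
Proof.
move=> E; have sz : `|regs st 0%N|%N = n.
  by have := congr1 size E; rewrite size_mkseq size_codom card_ord.
split=> // i; have := congr1 (fun l => nth 0 l i) E.
rewrite /= nth_mkseq ?sz // => ->.
by rewrite /codom /image_mem (nth_map i) ?size_enum_ord // nth_ord_enum.
Qed.

Theorem mainTheorem4 (R : realType) (A : problem) (t : nat -> nat) :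
  has_polynomial_formulation R A t ->
  exists Q : poly_family,
    (exists D : nat, explicit_family D Q) /\ POTIME_O R t Q A.
Proof.
move=> [D [P [explP [s [phi [eps [[mono s_le] _ [p phiP] yesP [eps0 bound]]]]]]]].
exists P; split; first by exists D.
(* Computing [phi x] costs at most [t n] and the tail at most [s n + 5 <= t n + 5]. Since a run has
   positive cost, [1 <= t n], and the total is below [2 * t n + 5 <= 7 * t n]. *)
exists (fun n => 7 * t n)%N; first by exists 7%N, 0%N.
exists (fiber_sup s eps), (map (clip (size p)) p ++ query_tail (size p)).
split=> [|x]; first exact: fiber_sup_cvg0.
have [st [c rc le_c] /output_codomE[r0 memE]] := phiP x.
set n := isize x in le_c r0 *.
have halted : (size p <= pc st)%N by elim: rc.
set O := poly_oracle P (fiber_sup s eps).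
have Ophi : O (s n) (phi x) = Some (meval (phi x) (P (s n))).
  rewrite /O /poly_oracle; case: ifPn => // /forallP[] i.
  apply: le_trans (ltW (bound x i)) _.
  apply: ler_powR; first by rewrite ler1n.
  apply: ler_powR; last exact: le_fiber_sup.
  (* Monotonicity in the exponent needs the base [s n] to be at least 1, which the index [i]
     witnesses. *)
  by rewrite ler1n; case: (s n) i => [[]|].
set w := word_length t n in rc.
set w' := word_length (fun n => 7 * t n)%N n.
have w0 : (0 < w)%N by [].
have ww' : (w <= w')%N by rewrite ltnS leq_trunc_log // leq_add2l leq_pmull.
have [||c2 [st2 [r2 le2 ans]]] := @run_query_tail w' O (map (clip (size p)) p)
  (clip_pc (size p) st) (meval (phi x) (P (s n))).
(* Since [p] has halted, its clipped counter is exactly [size p], where the tail begins. *)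
- by rewrite /= size_map; exact/minn_idPr.
- rewrite -Ophi; apply: poly_oracle_cast => // i j ij.
  by rewrite /= ij memE.
rewrite size_map in r2.
have [c' r' lt'] := run_cat w0 ww' rc r2.
exists st2.
  exists c'; first by rewrite clip_pc_id in r'.
  have := run_gt0 rc; have := s_le n; move: le2; rewrite /= r0.
  by lia.
rewrite ans; split; first by move=> /yesP ->.
by case: eqP => // /eqP ne0 []; apply/yesP.
Qed.
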